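(* Let $\Omega\subset\mathbb R^2$ be a rectangle with periodic boundary conditions and $\mathcal T_h$ a conforming Cartesian rectangular mesh; let $p\ge1$ and $m\in\{p-1,p\}$. Let $\rho_h\in V_h^p$ be fixed in time with positive nodal values, and let $\eta_h\in V_h^0$ be fixed in time with $\eta_h\ge0$. Let $(\boldsymbol u_h,\boldsymbol B_h,e_h,\boldsymbol J_h,\boldsymbol E_h)(t)\in X_h^p\times\mathcal B_h^m\times V_h^p\times\mathcal A_h^m\times\mathcal A_h^m$ solve the semidiscrete magnetic–velocity system $$\begin{aligned} (\rho_h\partial_t\boldsymbol u_h,\boldsymbol v_h)_{X,h}-\mathcal C_h(\boldsymbol v_h,\boldsymbol B_h;\boldsymbol J_h)&=0&&\forall\boldsymbol v_h\in X_h^p,\\ (\partial_t\boldsymbol B_h,\boldsymbol C_h)_{\mathcal B,h}+(\nabla\times\boldsymbol E_h,\boldsymbol C_h)_{\mathcal B,h}&=0&&\forall\boldsymbol C_h\in\mathcal B_h^m,\\ (\rho_h\partial_te_h,v_h)_{V,h}-(\eta_h|\boldsymbol J_h|^2,v_h)_{V,h}&=0&&\forall v_h\in V_h^p,\\ (\boldsymbol J_h,\boldsymbol\chi_h)_{\mathcal A,h}-(\boldsymbol B_h,\nabla\times\boldsymbol\chi_h)_{\mathcal B,h}&=0&&\forall\boldsymbol\chi_h\in\mathcal A_h^m,\\ (\boldsymbol E_h,\boldsymbol G_h)_{\mathcal A,h}-\mathcal C_h(\boldsymbol u_h,\boldsymbol B_h;\boldsymbol G_h)-(\eta_h\boldsymbol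 J_h\cdot\boldsymbol G_h,1)_{V,h}&=0&&\forall\boldsymbol G_h\in\mathcal A_h^m . \end{aligned}$$ Then $$\frac{d}{dt}E_{tot,h}(t)=0,\qquad E_{tot,h}=(\rho_he_h,1)_{V,h}+\tfrac12\|\sqrt{\rho_h}\boldsymbol u_h\|_{X,h}^2+\tfrac12\|\boldsymbol B_h\|_{\mathcal B,h}^2 .$$ Moreover, $$\frac{d}{dt}\Bigl[\tfrac12\|\sqrt{\rho_h}\boldsymbol u_h\|_{X,h}^2+\tfrac12\|\boldsymbol B_h\|_{\mathcal B,h}^2\Bigr]=-(\eta_h|\boldsymbol J_h|^2,1)_{V,h}\le0,\qquad \frac{d}{dt}(\rho_he_h,1)_{V,h}=(\eta_h|\boldsymbol J_h|^2,1)_{V,h}\ge0 .$$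
   Context: **Mesh.** Each $K\in\mathcal T_h$ is an axis-parallel rectangle with side lengths $h_{x,K},h_{y,K}$, image of $\widehat K=[-1,1]^2$ under the affine map $F_K$; $J_K=h_{x,K}h_{y,K}/4$. $\mathbb Q^{a,b}(K)$: polynomials of degree $\le a$ in $x$ and $\le b$ in $y$; $\mathbb Q^k=\mathbb Q^{k,k}$. For vector fields $\boldsymbol a=(a_x,a_y,a_z)$ depending on $(x,y)$: $\nabla\times\boldsymbol a=(\partial_ya_z,-\partial_xa_z,\partial_xa_y-\partial_ya_x)^T$. **Spaces** (periodic). $V_h^k=\{v\in L^2(\Omega):v|_K\in\mathbb Q^k(K)\}$; $W_h^{k+1}=\{w\in H^1(\Omega):w|_K\in\mathbb Q^{k+1}(K)\}$; $N_h^k=\{\boldsymbol g\in H(\mathrm{curl};\Omega):\boldsymbol g|_K\in\mathbb Q^{k,k+1}(K)\times\mathbb Q^{k+1,k}(K)\}$; $R_h^k=\{\boldsymbol r\in H(\mathrm{div};\Omega):\boldsymbol r|_K\in\mathbb Q^{k+1,k}(K)\times\mathbb Q^{k,k+1}(K)\}$. Then $X_h^p=(V_h^p)^3$, $\mathcal B_h^m=R_h^m\times V_h^m$ (in-plane components $\boldsymbol B_{\parallel,h}\in R_h^m$, out-of-plane $B_{z,h}\in V_h^m$), $\mathcal A_h^m=N_h^m\times W_h^{m+1}$ (in-plane, out-of-plane). The curl maps $\mathcal A_h^m$ into $\mathcal B_h^m$. **Quadratures.** $\xi^{(r)}_i,\omega_i^{(r)}$ ($0\le i\le r$): Gauss–Lobatto–Legendre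 (GLL) nodes/weights on $[-1,1]$ with $r+1$ points ($r\ge1$). $\zeta_i^{(k)},\varpi_i^{(k)}$ ($0\le i\le k$): $(k+1)$-point Gauss–Legendre rule. All products below are sums over elements $K$ of element contributions in which all functions are evaluated by their values from inside $K$ (points on $\widehat K$ are mapped by $F_K$): - $(f,g)_{V,h}$: on $K$, $J_K\sum_{i,j=0}^p\omega^{(p)}_i\omega_j^{(p)}(fg)(\xi_i^{(p)},\xi_j^{(p)})$ (degree-$p$ GLL rule; also applied to products of several functions). ''Nodal values'' of functions in $V_h^p$ are values at these points. - $(\rho_h\boldsymbol v,\boldsymbol z)_{X,h}=\sum_{d=x,y,z}(\rho_hv_d,z_d)_{V,h}$; $\|\sqrt{\rho_h}\boldsymbol v\|_{X,h}^2=(\rho_h\boldsymbol v,\boldsymbol v)_{X,h}$. - $(\boldsymbol F,\boldsymbol G)_{\mathcal A,h}$: on $K$, $J_K\sum_{i=0}^m\sum_{j=0}^{m+1}\varpi_i^{(m)}\omega_j^{(m+1)}(F_xG_x)(\zeta_i^{(m)},\xi_j^{(m+1)})+J_K\sum_{i=0}^{m+1}\sum_{j=0}^{m}\omega_i^{(m+1)}\varpi_j^{(m)}(F_yG_y)(\xi_i^{(m+1)},\zeta_j^{(m)})+J_K\sum_{i,j=0}^{m+1}\omega_i^{(m+1)}\omega_j^{(m+1)}(F_zG_z)(\xi_i^{(m+1)},\xi_j^{(m+1)})$. - $(\boldsymbol C,\boldsymbol D)_{\mathcal B,h}$: componentwise tensor Gauss rules which integrate products of functions in $\mathcal B_h^m$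 exactly, so that it equals $\int_\Omega\boldsymbol C\cdot\boldsymbol D\,dx$ on $\mathcal B_h^m$; $\|\boldsymbol C\|_{\mathcal B,h}^2=(\boldsymbol C,\boldsymbol C)_{\mathcal B,h}$. - $\mathcal C_h(\boldsymbol v_h,\boldsymbol B_h;\boldsymbol G_h)=(-\boldsymbol v_h\times\boldsymbol B_h,\boldsymbol G_h)_{\mathcal A,h}$, the cross product in $\mathbb R^3$ being evaluated pointwise at the quadrature nodes. *)

(* Defs.v *)
From mathcomp Require Import all_boot all_order all_algebra.
From mathcomp Require Import polyrcf.
From mathcomp Require Import all_classical all_reals all_analysis.

Set Implicit Arguments.
Unset Strict Implicit.
Unset Printing Implicit Defensive.
Import Order.TTheory GRing.Theory Num.Theory.
Import numFieldNormedType.Exports.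

Local Open Scope classical_set_scope.
Local Open Scope ring_scope.

(* A quadrature rule on [-1, 1] is the list of its (node, weight) pairs. *)

Definition rule (R : Type) := seq (R * R).

(* Rodrigues' formula *)
Definition legendre (R : realType) (n : nat) : {poly R} :=
  ((2 ^ n * n`!)%N%:R)^-1 *: (('X^2 - 1) ^+ n)^`(n).

(* The n-point Gauss-Legendre rule: the nodes are the n zeros of P_n.
   ([rootsR q] is the increasing list of all the real roots of q.) *)
Definition gauss (R : realType) (n : nat) : rule R :=
  [seq (z, 2 / ((1 - z ^+ 2) * (legendre R n)^`().[z] ^+ 2))
     | z <- rootsR (legendre R n)].

(* The (r+1)-point Gauss-Lobatto-Legendre rule, r >= 1: the nodes are -1, 1
   and the r - 1 zeros of P_r'. *)
Definition gll (R : realType) (r : nat) : rule R :=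
  [seq (z, 2 / ((r * r.+1)%N%:R * (legendre R r).[z] ^+ 2))
     | z <- rootsR ((1 - 'X^2) * (legendre R r)^`())].

(* A conforming partition of a rectangle into axis-parallel rectangles has no
   hanging node, hence is a tensor grid.  The spacing is arbitrary. *)

Record mesh (R : realType) := Mesh {
  nx : nat;
  ny : nat;
  gx : nat -> R;
  gy : nat -> R;
  nx_gt0 : (0 < nx)%N;
  ny_gt0 : (0 < ny)%N;
  gx_lt : forall i, (i < nx)%N -> gx i < gx i.+1;
  gy_lt : forall j, (j < ny)%N -> gy j < gy j.+1 }.

Definition elem (R : realType) (M : mesh R) : finType :=
  ('I_(nx M) * 'I_(ny M))%type.

Definition Omega (R : realType) (M : mesh R) : set (R * R) :=
  `[gx M 0, gx M (nx M)] `*` `[gy M 0, gy M (ny M)].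

(* Half-open, so that every point lies in at most one element. *)
Definition cell (R : realType) (M : mesh R) (K : elem M) : set (R * R) :=
  `[gx M K.1, gx M K.1.+1[ `*` `[gy M K.2, gy M K.2.+1[.

Definition hx (R : realType) (M : mesh R) (K : elem M) : R :=
  gx M K.1.+1 - gx M K.1.

Definition hy (R : realType) (M : mesh R) (K : elem M) : R :=
  gy M K.2.+1 - gy M K.2.

Definition jac (R : realType) (M : mesh R) (K : elem M) : R :=
  hx K * hy K / 4.

(* The affine map F_K, by coordinates. *)
Definition Fx (R : realType) (M : mesh R) (K : elem M) (s : R) : R :=
  gx M K.1 + hx K * (s + 1) / 2.

Definition Fy (R : realType) (M : mesh R) (K : elem M) (s : R) : R :=
  gy M K.2 + hy K * (s + 1) / 2.

(* [f K] stands for f|_K.  In the discrete spaces it is a polynomial, hence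
   is given on the whole plane, and its value at a boundary point of K is the
   value from inside K; the function on Omega is [on_Omega f]. *)

Definition bfield (R : realType) (M : mesh R) := elem M -> R -> R -> R.

Record vfield (R : realType) (M : mesh R) := VField {
  cx : bfield M;
  cy : bfield M;
  cz : bfield M }.

Definition on_Omega (R : realType) (M : mesh R) (f : bfield M) : R * R -> R :=
  fun z => \sum_(K : elem M) f K z.1 z.2 * \1_(cell K) z.

Definition bone (R : realType) (M : mesh R) : bfield M := fun _ _ _ => 1.

Definition bmul (R : realType) (M : mesh R) (f g : bfield M) : bfield M :=
  fun K x y => f K x y * g K x y.

Definition bscale (R : realType) (M : mesh R) (f : bfield M) (v : vfield M) :
    vfield M :=
  VField (bmul f (cx v)) (bmul f (cy v)) (bmul f (cz v)).

Definition bdot (R : realType) (M : mesh R) (v w : vfield M) : bfield M :=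
  fun K x y => cx v K x y * cx w K x y + cy v K x y * cy w K x y
               + cz v K x y * cz w K x y.

Definition bcross (R : realType) (M : mesh R) (v w : vfield M) : vfield M :=
  VField
    (fun K x y => cy v K x y * cz w K x y - cz v K x y * cy w K x y)
    (fun K x y => cz v K x y * cx w K x y - cx v K x y * cz w K x y)
    (fun K x y => cx v K x y * cy w K x y - cy v K x y * cx w K x y).

Definition bopp (R : realType) (M : mesh R) (v : vfield M) : vfield M :=
  VField (fun K x y => - cx v K x y) (fun K x y => - cy v K x y)
         (fun K x y => - cz v K x y).

Definition dx (R : realType) (f : R -> R -> R) : R -> R -> R :=
  fun x y => derive1 (fun s : R => f s y) x.

Definition dy (R : realType) (f : R -> R -> R) : R -> R -> R :=
  fun x y => derive1 (fun s : R => f x s) y.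

(* On H(curl) x H^1-conforming fields the elementwise curl is the weak curl. *)
Definition bcurl (R : realType) (M : mesh R) (a : vfield M) : vfield M :=
  VField (fun K => dy (cz a K))
         (fun K x y => - dx (cz a K) x y)
         (fun K x y => dx (cy a K) x y - dy (cx a K) x y).

Definition bdt (R : realType) (M : mesh R) (f : R -> bfield M) (t : R) :
    bfield M :=
  fun K x y => derive1 (fun s : R => f s K x y) t.

Definition vdt (R : realType) (M : mesh R) (v : R -> vfield M) (t : R) :
    vfield M :=
  VField (bdt (fun s => cx (v s)) t) (bdt (fun s => cy (v s)) t)
         (bdt (fun s => cz (v s)) t).

(* For maps into a finite-dimensional space of polynomials, this is
   differentiability in that space. *)
Definition bdiff (R : realType) (M : mesh R) (f : R -> bfield M) (t : R) :=
  forall K x y, derivable (fun s : R => f s K x y) t 1.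

Definition vdiff (R : realType) (M : mesh R) (v : R -> vfield M) (t : R) :=
  [/\ bdiff (fun s => cx (v s)) t, bdiff (fun s => cy (v s)) t
    & bdiff (fun s => cz (v s)) t].

Definition mu2 (R : realType) :=
  ((@lebesgue_measure R) \x (@lebesgue_measure R))%E.

Definition L2 (R : realType) (M : mesh R) (f : R * R -> R) :=
  measurable_fun (Omega M) f /\
  (@mu2 R).-integrable (Omega M) (fun z => (f z ^+ 2)%:E).

Fixpoint Cn (R : realType) (n : nat) (f : R -> R -> R) : Prop :=
  continuous (fun z : R * R => f z.1 z.2) /\
  if n is n'.+1 then
    [/\ forall x y, derivable (fun s : R => f s y) x 1,
        forall x y, derivable (fun s : R => f x s) y 1,
        Cn n' (dx f) & Cn n' (dy f)]
  else True.

(* Test functions on the torus: smooth Omega-periodic functions. *)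
Definition test_fun (R : realType) (M : mesh R) (phi : R -> R -> R) :=
  [/\ forall n, Cn n phi,
      forall x y, phi (x + (gx M (nx M) - gx M 0)) y = phi x y
    & forall x y, phi x (y + (gy M (ny M) - gy M 0)) = phi x y].

(* The weak divergence of (a, b) on the torus is d. *)
Definition weak_div (R : realType) (M : mesh R) (a b d : R * R -> R) :=
  forall phi, test_fun M phi ->
    \int[@mu2 R]_(z in Omega M)
       (a z * dx phi z.1 z.2 + b z * dy phi z.1 z.2)
    = - \int[@mu2 R]_(z in Omega M) (d z * phi z.1 z.2).

Definition weak_dx (R : realType) (M : mesh R) (w d : R * R -> R) :=
  weak_div M w (fun=> 0) d.

Definition weak_dy (R : realType) (M : mesh R) (w d : R * R -> R) :=
  weak_div M (fun=> 0) w d.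

(* The scalar curl of (a, b) is the divergence of (b, - a). *)
Definition weak_curl (R : realType) (M : mesh R) (a b d : R * R -> R) :=
  weak_div M b (fun z => - a z) d.

Definition H1 (R : realType) (M : mesh R) (w : R * R -> R) :=
  L2 M w /\
  exists d1 d2, [/\ L2 M d1, L2 M d2, weak_dx M w d1 & weak_dy M w d2].

Definition Hdiv (R : realType) (M : mesh R) (a b : R * R -> R) :=
  [/\ L2 M a, L2 M b & exists2 d, L2 M d & weak_div M a b d].

Definition Hcurl (R : realType) (M : mesh R) (a b : R * R -> R) :=
  [/\ L2 M a, L2 M b & exists2 d, L2 M d & weak_curl M a b d].

Definition polyQ (R : realType) (a b : nat) (f : R -> R -> R) :=
  exists c : nat -> nat -> R, forall x y,
    f x y = \sum_(i < a.+1) \sum_(j < b.+1) c i j * x ^+ i * y ^+ j.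

Definition inV (R : realType) (M : mesh R) (k : nat) (v : bfield M) :=
  L2 M (on_Omega v) /\ forall K, polyQ k k (v K).

Definition inW (R : realType) (M : mesh R) (k : nat) (w : bfield M) :=
  H1 M (on_Omega w) /\ forall K, polyQ k k (w K).

Definition inN (R : realType) (M : mesh R) (k : nat) (g1 g2 : bfield M) :=
  Hcurl M (on_Omega g1) (on_Omega g2) /\
  forall K, polyQ k k.+1 (g1 K) /\ polyQ k.+1 k (g2 K).

Definition inR (R : realType) (M : mesh R) (k : nat) (r1 r2 : bfield M) :=
  Hdiv M (on_Omega r1) (on_Omega r2) /\
  forall K, polyQ k.+1 k (r1 K) /\ polyQ k k.+1 (r2 K).

Definition inX (R : realType) (M : mesh R) (p : nat) (v : vfield M) :=
  [/\ inV p (cx v), inV p (cy v) & inV p (cz v)].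

Definition inB (R : realType) (M : mesh R) (m : nat) (v : vfield M) :=
  inR m (cx v) (cy v) /\ inV m (cz v).

Definition inA (R : realType) (M : mesh R) (m : nat) (v : vfield M) :=
  inN m (cx v) (cy v) /\ inW m.+1 (cz v).

Definition quad (R : realType) (M : mesh R) (q1 q2 : rule R) (f : bfield M) :
    R :=
  \sum_(K : elem M) jac K *
    \sum_(a <- q1) \sum_(b <- q2) a.2 * b.2 * f K (Fx K a.1) (Fy K b.1).

Definition prodV (R : realType) (M : mesh R) (p : nat) (f g : bfield M) : R :=
  quad (gll R p) (gll R p) (bmul f g).

Definition prodX (R : realType) (M : mesh R) (p : nat) (v w : vfield M) : R :=
  prodV p (cx v) (cx w) + prodV p (cy v) (cy w) + prodV p (cz v) (cz w).

Definition prodA (R : realType) (M : mesh R) (m : nat) (F G : vfield M) : R :=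
  quad (gauss R m.+1) (gll R m.+1) (bmul (cx F) (cx G))
  + quad (gll R m.+1) (gauss R m.+1) (bmul (cy F) (cy G))
  + quad (gll R m.+1) (gll R m.+1) (bmul (cz F) (cz G)).

(* For each component, the numbers of Gauss points in the x and y
   directions. *)
Record Brule := BRule { nBx : nat * nat; nBy : nat * nat; nBz : nat * nat }.

Definition prodB (R : realType) (M : mesh R) (n : Brule) (C D : vfield M) : R :=
  quad (gauss R (nBx n).1) (gauss R (nBx n).2) (bmul (cx C) (cx D))
  + quad (gauss R (nBy n).1) (gauss R (nBy n).2) (bmul (cy C) (cy D))
  + quad (gauss R (nBz n).1) (gauss R (nBz n).2) (bmul (cz C) (cz D)).

Definition exactB (R : realType) (M : mesh R) (m : nat) (n : Brule) :=
  forall C D : vfield M, inB m C -> inB m D ->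
    prodB n C D = \int[@mu2 R]_(z in Omega M)
      (on_Omega (cx C) z * on_Omega (cx D) z + on_Omega (cy C) z * on_Omega (cy D) z
       + on_Omega (cz C) z * on_Omega (cz D) z).

Definition triC (R : realType) (M : mesh R) (m : nat) (v B G : vfield M) : R :=
  prodA m (bopp (bcross v B)) G.

Definition sqnormX (R : realType) (M : mesh R) (p : nat) (rho : bfield M)
    (v : vfield M) : R :=
  prodX p (bscale rho v) v.

Definition sqnormB (R : realType) (M : mesh R) (n : Brule) (C : vfield M) : R :=
  prodB n C C.

Definition Eint (R : realType) (M : mesh R) (p : nat) (rho e : bfield M) : R :=
  prodV p (bmul rho e) (@bone R M).

Definition Ekinmag (R : realType) (M : mesh R) (p : nat) (n : Brule)
    (rho : bfield M) (u B : vfield M) : R :=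
  2^-1 * sqnormX p rho u + 2^-1 * sqnormB n B.

Definition Etot (R : realType) (M : mesh R) (p : nat) (n : Brule)
    (rho : bfield M) (u B : vfield M) (e : bfield M) : R :=
  Eint p rho e + 2^-1 * sqnormX p rho u + 2^-1 * sqnormB n B.

Definition dissip (R : realType) (M : mesh R) (p : nat) (eta : bfield M)
    (J : vfield M) : R :=
  prodV p (bmul eta (bdot J J)) (@bone R M).

(* Main.v *)
(** The sum of the kinetic and magnetic rates is obtained by testing momentum
with [u], Faraday's law with [B], Ampere's law with [E] and Ohm's law with [J]:
the Lorentz-force work [triC u B J] cancels because the same quadrature serves
both equations, and the symmetry of the discrete products turns
[(B, curl E)] into [(E, J)], leaving minus the resistive dissipation.  Testing
the energy equation with the constant 1 returns exactly that dissipation.  It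
is nonnegative because the Gauss-Lobatto weights are, and because [eta] is
constant on each element. *)

Require Import Defs.
From mathcomp Require Import all_boot all_order all_algebra.
From mathcomp Require Import all_classical all_reals all_analysis.
From mathcomp Require Import measurable_realfun ring lra.
Import Order.TTheory GRing.Theory Num.Theory.
Import numFieldNormedType.Exports.

Local Open Scope classical_set_scope.
Local Open Scope ring_scope.

(** * Quadrature sums and their time derivatives *)

Lemma eq_quad (R : realType) (M : mesh R) (q1 q2 : rule R) (f g : bfield M) :
  (forall K x y, f K x y = g K x y) -> quad q1 q2 f = quad q1 q2 g.
Proof.
by move=> fg; apply: eq_bigr => K _; congr (_ * _); apply: eq_bigr => a _;
  apply: eq_bigr => b _; rewrite fg.
Qed.

Lemma quadZ (R : realType) (M : mesh R) (q1 q2 : rule R) (c : R)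
    (f : bfield M) :
  quad q1 q2 (fun K x y => c * f K x y) = c * quad q1 q2 f.
Proof.
rewrite /quad mulr_sumr; apply: eq_bigr => K _.
rewrite mulrCA; congr (_ * _); rewrite mulr_sumr; apply: eq_bigr => a _.
by rewrite mulr_sumr; apply: eq_bigr => b _; rewrite mulrCA.
Qed.

Lemma is_derive_bigsum (R : realType) (I : Type) (r : seq I)
    (F : I -> R -> R) (dF : I -> R) (t : R) :
  (forall i, is_derive t (1 : R) (F i) (dF i)) ->
  is_derive t (1 : R) (fun s => \sum_(i <- r) F i s) (\sum_(i <- r) dF i).
Proof.
move=> FdF; elim: r => [|i r IHr].
  rewrite big_nil; under eq_fun do rewrite big_nil.
  exact: is_derive_cst.
by rewrite big_cons; under eq_fun do rewrite big_cons; exact: is_deriveD.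
Qed.

(** A quadrature is a finite combination of point values with weights fixed in time, so
    differentiability in time at each point of the plane suffices. *)
Lemma is_derive_quad (R : realType) (M : mesh R) (q1 q2 : rule R)
    (f : R -> bfield M) (f' : bfield M) (t : R) :
  (forall K x y, is_derive t (1 : R) (fun s => f s K x y) (f' K x y)) ->
  is_derive t (1 : R) (fun s => quad q1 q2 (f s)) (quad q1 q2 f').
Proof.
move=> df; apply: is_derive_bigsum => K; apply: is_deriveZ.
by apply: is_derive_bigsum => a; apply: is_derive_bigsum => b.
Qed.

Lemma is_derive_bdt (R : realType) (M : mesh R) (f : R -> bfield M) (t : R)
    (K : elem M) (x y : R) :
  bdiff f t -> is_derive t (1 : R) (fun s => f s K x y) (bdt f t K x y).
Proof. by move=> /(_ K x y)/derivableP; rewrite /bdt derive1E. Qed.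

Lemma is_derive_half_quad_sqr (R : realType) (M : mesh R) (q1 q2 : rule R)
    (f : R -> bfield M) (t : R) : bdiff f t ->
  is_derive t (1 : R) (fun s => 2^-1 * quad q1 q2 (bmul (f s) (f s)))
    (quad q1 q2 (bmul (bdt f t) (f t))).
Proof.
move=> df.
(* The product rule for [f * f] yields two equal summands, which the factor 1/2 merges into one. *)
have -> : quad q1 q2 (bmul (bdt f t) (f t)) =
    2^-1 * quad q1 q2 (fun K x y =>
      f t K x y * bdt f t K x y + f t K x y * bdt f t K x y).
  by rewrite -quadZ; apply: eq_quad => K x y; rewrite /bmul; field.
apply: is_deriveZ; apply: is_derive_quad => K x y.
by apply: is_deriveM; exact: is_derive_bdt.
Qed.

Lemma is_derive_half_quad_wsqr (R : realType) (M : mesh R) (q1 q2 : rule R)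
    (w : bfield M) (f : R -> bfield M) (t : R) : bdiff f t ->
  is_derive t (1 : R)
    (fun s => 2^-1 * quad q1 q2 (bmul (bmul w (f s)) (f s)))
    (quad q1 q2 (bmul (bmul w (bdt f t)) (f t))).
Proof.
move=> df.
have -> : quad q1 q2 (bmul (bmul w (bdt f t)) (f t)) =
    2^-1 * quad q1 q2 (fun K x y => w K x y *
      (f t K x y * bdt f t K x y + f t K x y * bdt f t K x y)).
  by rewrite -quadZ; apply: eq_quad => K x y; rewrite /bmul; field.
apply: is_deriveZ; apply: is_derive_quad => K x y.
(* Reassociation isolates [w], which is fixed in time, as a constant factor. *)
under eq_fun do rewrite /bmul -mulrA.
by apply: is_deriveZ; apply: is_deriveM; exact: is_derive_bdt.
Qed.

Lemma is_derive_kinetic (R : realType) (M : mesh R) (p : nat)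
    (rho : bfield M) (u : R -> vfield M) (t : R) : vdiff u t ->
  is_derive t (1 : R) (fun s => 2^-1 * sqnormX p rho (u s))
    (prodX p (bscale rho (vdt u t)) (u t)).
Proof.
move=> [dux duy duz]; rewrite /sqnormX /prodX /prodV.
under eq_fun do rewrite !mulrDr.
by apply: is_deriveD; first apply: is_deriveD;
  exact: is_derive_half_quad_wsqr.
Qed.

Lemma is_derive_magnetic (R : realType) (M : mesh R) (n : Brule)
    (B : R -> vfield M) (t : R) : vdiff B t ->
  is_derive t (1 : R) (fun s => 2^-1 * sqnormB n (B s))
    (prodB n (vdt B t) (B t)).
Proof.
move=> [dBx dBy dBz]; rewrite /sqnormB /prodB.
under eq_fun do rewrite !mulrDr.
by apply: is_deriveD; first apply: is_deriveD;
  exact: is_derive_half_quad_sqr.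
Qed.

Lemma is_derive_Eint (R : realType) (M : mesh R) (p : nat)
    (rho : bfield M) (e : R -> bfield M) (t : R) : bdiff e t ->
  is_derive t (1 : R) (fun s => Eint p rho (e s))
    (prodV p (bmul rho (bdt e t)) (@bone R M)).
Proof.
move=> de; apply: is_derive_quad => K x y.
rewrite /bmul /bone mulr1; under eq_fun do rewrite mulr1.
by apply: is_deriveZ; exact: is_derive_bdt.
Qed.

(** * Symmetry and sign of the discrete products *)

Lemma prodBC (R : realType) (M : mesh R) (n : Brule) (C D : vfield M) :
  prodB n C D = prodB n D C.
Proof.
by rewrite /prodB; congr (_ + _ + _); apply: eq_quad => K x y;
  rewrite /bmul mulrC.
Qed.

Lemma prodAC (R : realType) (M : mesh R) (m : nat) (F G : vfield M) :
  prodA m F G = prodA m G F.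
Proof.
by rewrite /prodA; congr (_ + _ + _); apply: eq_quad => K x y;
  rewrite /bmul mulrC.
Qed.

Lemma quad_ge0 (R : realType) (M : mesh R) (q1 q2 : rule R) (f : bfield M) :
  (forall a, a \in q1 -> 0 <= a.2) -> (forall b, b \in q2 -> 0 <= b.2) ->
  (forall K x y, 0 <= f K x y) -> 0 <= quad q1 q2 f.
Proof.
move=> q1_ge0 q2_ge0 f_ge0; apply: sumr_ge0 => K _; apply: mulr_ge0.
  by rewrite divr_ge0 ?mulr_ge0 ?subr_ge0 ?ltW ?gx_lt ?gy_lt.
rewrite big_seq_cond; apply: sumr_ge0 => a /andP[aq1 _].
rewrite big_seq_cond; apply: sumr_ge0 => b /andP[bq2 _].
by apply: mulr_ge0 => //; apply: mulr_ge0; [exact: q1_ge0 | exact: q2_ge0].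
Qed.

(** The denominator of the weight is a natural number times a square. Were it zero, the quotient
    would be 0 by convention, so the weak inequality holds without locating the zeros of
    [legendre R r]. *)
Lemma gll_weight_ge0 (R : realType) (r : nat) (a : R * R) :
  a \in gll R r -> 0 <= a.2.
Proof.
by case/mapP => z _ -> /=; apply: divr_ge0 => //; apply: mulr_ge0 => //;
  exact: sqr_ge0.
Qed.

(** The sign is given only on the half-open cell, whereas Gauss-Lobatto nodes also lie on the right
    and upper edges. Being constant, [f K] takes everywhere its value at the lower left corner,
    which belongs to the cell. *)
Lemma polyQ00_ge0 (R : realType) (M : mesh R) (f : bfield M) (K : elem M) :
  polyQ 0 0 (f K) -> (forall z, cell K z -> 0 <= f K z.1 z.2) ->
  forall x y, 0 <= f K x y.
Proof.
move=> [c fE] f_ge0 x y.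
have -> : f K x y = f K (gx M K.1) (gy M K.2) by rewrite !fE !big_ord1 !expr0.
apply: (f_ge0 (gx M K.1, gy M K.2)).
by split; rewrite /= in_itv /= lexx ?gx_lt ?gy_lt.
Qed.

Lemma dissip_ge0 (R : realType) (M : mesh R) (p : nat) (eta : bfield M)
    (J : vfield M) :
  inV 0 eta -> (forall (K : elem M) z, cell K z -> 0 <= eta K z.1 z.2) ->
  0 <= dissip p eta J.
Proof.
move=> [_ eta_poly] eta_ge0; apply: quad_ge0 => [a|a|K x y].
- exact: gll_weight_ge0.
- exact: gll_weight_ge0.
rewrite /bmul /bone mulr1; apply: mulr_ge0.
  by apply: polyQ00_ge0 => //; exact: eta_ge0.
by rewrite /bdot -!expr2 !addr_ge0 ?sqr_ge0.
Qed.

(** * The constant 1 as a test function for the energy equation *)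

Lemma measurable_Omega (R : realType) (M : mesh R) : measurable (Omega M).
Proof. by apply: measurableX; exact: measurable_itv. Qed.

Lemma mu2_Omega (R : realType) (M : mesh R) : (@mu2 R (Omega M) < +oo)%E.
Proof.
rewrite /mu2 /Omega product_measure1E //= !lebesgue_measure_itv /=.
(* Each interval length is a conditional on the order of its endpoints; both branches are finite. *)
by do 2 case: ifP => _; rewrite ?mul0e ?mule0 -?EFinB -?EFinM ltry.
Qed.

Lemma measurable_on_Omega_bone (R : realType) (M : mesh R) :
  measurable_fun (Omega M) (on_Omega (@bone R M)).
Proof.
apply: measurable_sum => K; apply: measurable_funM => //.
apply: measurable_indic; apply: measurableX; exact: measurable_itv.
Qed.

Lemma polyQ_cst (R : realType) (a b : nat) (k : R) :
  polyQ a b (fun _ _ => k).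
Proof.
exists (fun i j => if (i == 0)%N && (j == 0)%N then k else 0) => x y.
rewrite big_ord_recl big_ord_recl /= !expr0 !mulr1.
rewrite big1 ?addr0 => [|j _]; last by rewrite /= !mul0r.
by rewrite big1 ?addr0 // => i _; rewrite big1 // => j _; rewrite /= !mul0r.
Qed.

Lemma inV_bone (R : realType) (M : mesh R) (p : nat) : inV p (@bone R M).
Proof.
split; last by move=> K; exact: polyQ_cst.
split; first exact: measurable_on_Omega_bone.
apply: measurable_bounded_integrable.
- exact: measurable_Omega.
- exact: mu2_Omega.
- by apply: measurable_funX; exact: measurable_on_Omega_bone.
(* A crude bound: [on_Omega] of the constant 1 is a sum of [#|elem M|] indicators, each at most 1,
   and L2 membership concerns its square. *)
exists (#|elem M|%:R ^+ 2); split; first exact: num_real.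
move=> r ltr z _; apply: le_trans (ltW ltr).
rewrite normrX lerXn2r ?nnegrE ?ler0n //.
apply: le_trans (ler_norm_sum _ _ _) _.
rewrite -sum1_card natr_sum; apply: ler_sum => K _.
by rewrite /bone mul1r indicE; case: (_ \in _); rewrite ?normr1 ?normr0.
Qed.

Theorem theorem3 (R : realType) (M : mesh R) (p m : nat) (nB : Brule)
    (rho eta : bfield M) (T : set R)
    (u B : R -> vfield M) (e : R -> bfield M) (J E : R -> vfield M)
    (hp : (1 <= p)%N) (hm : m = (p - 1)%N \/ m = p)
    (hnB : exactB M m nB)
    (hrho : inV p rho)
    (hrho_pos : forall (K : elem M) (a b : R * R),
       a \in gll R p -> b \in gll R p -> 0 < rho K (Fx K a.1) (Fy K b.1))
    (heta : inV 0 eta)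
    (heta_ge0 : forall (K : elem M) (z : R * R),
       cell K z -> 0 <= eta K z.1 z.2)
    (hT : open T) (hTitv : is_interval T)
    (hu : forall t, T t -> inX p (u t))
    (hB : forall t, T t -> inB m (B t))
    (he : forall t, T t -> inV p (e t))
    (hJ : forall t, T t -> inA m (J t))
    (hE : forall t, T t -> inA m (E t))
    (hdu : forall t, T t -> vdiff u t)
    (hdB : forall t, T t -> vdiff B t)
    (hde : forall t, T t -> bdiff e t)
    (momentum : forall t, T t -> forall v : vfield M, inX p v ->
       prodX p (bscale rho (vdt u t)) v - triC m v (B t) (J t) = 0)
    (faraday : forall t, T t -> forall C : vfield M, inB m C ->
       prodB nB (vdt B t) C + prodB nB (bcurl (E t)) C = 0)
    (energy : forall t, T t -> forall v : bfield M, inV p v ->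
       prodV p (bmul rho (bdt e t)) v
       - prodV p (bmul eta (bdot (J t) (J t))) v = 0)
    (ampere : forall t, T t -> forall chi : vfield M, inA m chi ->
       prodA m (J t) chi - prodB nB (B t) (bcurl chi) = 0)
    (ohm : forall t, T t -> forall G : vfield M, inA m G ->
       prodA m (E t) G - triC m (u t) (B t) G
       - prodV p (bmul eta (bdot (J t) G)) (@bone R M) = 0) :
  forall t, T t ->
    [/\ is_derive t (1 : R) (fun s => Etot p nB rho (u s) (B s) (e s)) 0,
        is_derive t (1 : R) (fun s => Ekinmag p nB rho (u s) (B s))
          (- dissip p eta (J t)),
        - dissip p eta (J t) <= 0,
        is_derive t (1 : R) (fun s => Eint p rho (e s)) (dissip p eta (J t))
      & 0 <= dissip p eta (J t)].
Proof.
move=> t Tt.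
have dE := is_derive_Eint R M p rho e t (hde t Tt).
have dK := is_derive_kinetic R M p rho u t (hdu t Tt).
have dB := is_derive_magnetic R M nB B t (hdB t Tt).
have D_ge0 := dissip_ge0 R M p eta (J t) heta heta_ge0.
have internal : prodV p (bmul rho (bdt e t)) (@bone R M) = dissip p eta (J t).
  by apply/eqP; rewrite -subr_eq0; apply/eqP/energy => //; exact: inV_bone.
have kinmag : prodX p (bscale rho (vdt u t)) (u t) +
    prodB nB (vdt B t) (B t) = - dissip p eta (J t).
  have mom := momentum _ Tt _ (hu _ Tt).
  have far := faraday _ Tt _ (hB _ Tt).
  have amp := ampere _ Tt _ (hE _ Tt).
  have := ohm _ Tt _ (hJ _ Tt).
  (* Both symmetries align the four tested equations on the common terms [triC m (u t) (B t) (J t)],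
     [prodA m (J t) (E t)] and [prodB nB (bcurl (E t)) (B t)]; eliminating these is linear. *)
  rewrite prodAC -/(dissip p eta (J t)).
  rewrite prodBC in amp.
  lra.
rewrite internal in dE.
have dKB : is_derive t (1 : R) (fun s => Ekinmag p nB rho (u s) (B s))
    (- dissip p eta (J t)).
  by rewrite -kinmag; exact: is_deriveD.
split => //; last by rewrite oppr_le0.
(* Regrouped, the total is [Eint] plus [Ekinmag] up to unfolding, and their rates are opposite. *)
rewrite /Etot; under eq_fun do rewrite -addrA.
by rewrite -(subrr (dissip p eta (J t))); exact: is_deriveD.
Qed.
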